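(* Let $q$ be a prime power and let $\mathcal{A}$ be a central hyperplane arrangement in $\mathbb{F}_q^3$. If $\chi(\mathcal{A},q)=0$, then $\mathcal{A}$ is free with exponents $(1,q,|\mathcal{A}|-q-1)$.
   Context: A (central) hyperplane arrangement $\mathcal{A}$ in $V=\mathbb{K}^\ell$ is a finite set of codimension-one linear subspaces. Characteristic polynomial: $\chi(\mathcal{A},t)=\sum_{X\in L(\mathcal{A})}\mu(X)t^{\dim X}$, where $L(\mathcal{A})$ is the set of intersections of subsets of $\mathcal{A}$ (including $V$) ordered by reverse inclusion with minimum $\hat0=V$, and $\mu(\hat0)=1$, $\mu(X)=-\sum_{Y<X}\mu(Y)$ for $X>\hat0$. Let $S=\mathbb{K}[x_1,\dots,x_\ell]$, fix for each $H\in\mathcal{A}$ a nonzero linear form $\alpha_H$ with kernel $H$; $D(\mathcal{A})=\{\delta\in \mathrm{Der}_V : \delta(\alpha_H)\in\alpha_H S\ \forall H\in\mathcal{A}\}$, where $\mathrm{Der}_V=\bigoplus_i S\,\partial/\partial x_i$. $\mathcal{A}$ is free if $D(\mathcal{A})$ is a free $S$-module; the exponents are the multiset of degrees of a homogeneous basis. *)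

(* Defs.v *)
From HB Require Import structures.
From mathcomp Require Import all_boot all_order all_algebra.
From mathcomp Require Import mpoly.
Set Implicit Arguments. Unset Strict Implicit. Unset Printing Implicit Defensive.
Import GRing.Theory.
Local Open Scope ring_scope.

Section Arr.
Variables (F : fieldType) (l : nat).
Notation V := 'rV[F]_l.

Definition is_hyperplane (H : {vspace V}) : bool := \dim H == l.-1.

Definition is_arrangement (A : seq {vspace V}) : bool :=
  uniq A && all is_hyperplane A.

Definition inter_of (A : seq {vspace V}) (B : {set 'I_(size A)}) : {vspace V} :=
  (\bigcap_(i in B) nth 0%VS A i)%VS.

Definition Lat (A : seq {vspace V}) : seq {vspace V} :=
  undup [seq inter_of B | B <- enum {set 'I_(size A)}].

(* Moebius function, L(A) ordered by reverse inclusion, minimum V: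
   mu(V) = 1, mu(X) = - sum_{Y in L, Y < X} mu(Y), where Y < X iff X is a
   proper subspace of Y.  Computed with fuel; fuel l.+1 suffices since strict
   chains of subspaces of V have length at most l. *)
Fixpoint mu_fuel (A : seq {vspace V}) (n : nat) (X : {vspace V}) : int :=
  if n is n'.+1 then
    if X == fullv then 1
    else - \sum_(Y <- Lat A | (X <= Y)%VS && (X != Y)) mu_fuel A n' Y
  else 0.

Definition mobius (A : seq {vspace V}) (X : {vspace V}) : int :=
  mu_fuel A l.+1 X.

Definition arr_charpoly (A : seq {vspace V}) : {poly int} :=
  \sum_(X <- Lat A) (mobius A X)%:P * 'X^(\dim X).

(* S = F[x_1..x_l]; a derivation sum_i theta_i d/dx_i is the l-tuple theta. *)
Notation S := {mpoly F[l]}.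

Definition lin_form (a : V) : S := \sum_(i < l) a 0 i *: 'X_i.

Definition der_apply (theta : 'I_l -> S) (a : V) : S :=
  \sum_(i < l) a 0 i *: theta i.

Definition defines (a : V) (H : {vspace V}) : Prop :=
  forall v : V, (v \in H) = (\sum_(i < l) v 0 i * a 0 i == 0).

Definition in_DA (A : seq {vspace V}) (theta : 'I_l -> S) : Prop :=
  forall H, H \in A -> forall a : V, defines a H ->
    exists g : S, der_apply theta a = lin_form a * g.

Definition homog_of_deg (d : nat) (p : S) : bool :=
  all (fun m => mdeg m == d) (msupp p).

Definition homog_der (d : nat) (theta : 'I_l -> S) : Prop :=
  forall i, homog_of_deg d (theta i).

Definition free_with_exponents (A : seq {vspace V}) (d : 'I_l -> nat) : Prop :=
  exists theta : 'I_l -> 'I_l -> S,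
    [/\ forall j, in_DA A (theta j),
        forall j, homog_der (d j) (theta j),
        forall delta, in_DA A delta ->
          exists f : 'I_l -> S, forall i, delta i = \sum_j f j * theta j i
      & forall f : 'I_l -> S, (forall i, \sum_j f j * theta j i = 0) ->
          forall j, f j = 0].

End Arr.

Definition exps3 (a b c : nat) : 'I_3 -> nat :=
  fun j => nth 0%N [:: a; b; c] j.

(* Main.v *)
Require Import Defs.
From HB Require Import structures.
From mathcomp Require Import all_boot all_order all_algebra.
From mathcomp Require Import abelian finfield.
From mathcomp Require Import mpoly.
From mathcomp Require Import ring zify.

(* By Crapo--Rota, chi(A, q) is the number of points of F_q^3 off A, so here A
   covers F_q^3 and the defining polynomial Q vanishes at every point.
   Homogeneous polynomials vanishing on F_q^n lie in the ideal generated by the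
   minors x_i x_j^q - x_j x_i^q, whence, for n = 3, Q = det(x, x^q, T) for some
   homogeneous vector T of degree |A| - q - 1. The Euler derivation x and the
   Frobenius derivation x^q lie in D(A) for every A, and the divisibility of the
   determinant by each linear form forces T into D(A), so that Saito's criterion
   applies. *)

Set Implicit Arguments. Unset Strict Implicit. Unset Printing Implicit Defensive.
Import GRing.Theory.
Local Open Scope ring_scope.

(** * Möbius sums over flats and the count of uncovered points *)

Section CharPoly.
Variables (F : fieldType) (l : nat).
Implicit Types (A : seq {vspace 'rV[F]_l}) (X Y : {vspace 'rV[F]_l}).

Lemma dimv_proper X Y : (X <= Y)%VS -> X != Y -> (\dim X < \dim Y)%N.
Proof.
by move=> sXY neq; rewrite ltnNge; apply: contra neq => dYX; rewrite eqEdim sXY.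
Qed.

Lemma dimv_rVf : \dim {:'rV[F]_l} = l.
Proof. by rewrite dimvf /dim /= mul1n. Qed.

Lemma dimv_le_row X : (\dim X <= l)%N.
Proof. by rewrite -[in leqRHS]dimv_rVf dimvS ?subvf. Qed.

(** Each recursive call passes to a strictly larger subspace, so fuel exceeding the codimension of X
    never runs out. *)
Lemma mu_fuel_stable A n m X :
  (l - \dim X < n)%N -> (l - \dim X < m)%N -> mu_fuel A n X = mu_fuel A m X.
Proof.
elim: n m X => // n IH [|m] X //= ln lm; case: ifP => // _; congr (- _).
apply: eq_bigr => Y /andP[sXY neq].
have := dimv_proper sXY neq; have := dimv_le_row Y => ? ?.
by apply: IH; lia.
Qed.

Lemma mobius_fullv A : mobius A fullv = 1.
Proof. by rewrite /mobius /= eqxx. Qed.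

Lemma sum_mobius_above A X : X \in Lat A ->
  \sum_(Y <- Lat A | (X <= Y)%VS) mobius A Y = (X == fullv)%:R.
Proof.
move=> XL; rewrite -big_filter (bigD1_seq X) ?filter_uniq ?undup_uniq //=; last first.
  by rewrite mem_filter subvv.
rewrite big_filter_cond.
have [->|nX] := eqVneq X fullv.
  rewrite mobius_fullv big1 ?addr0 // => Y /andP[sY]; rewrite eqEsubv sY.
  by rewrite subvf.
rewrite {1}/mobius /= (negPf nX); apply/eqP; rewrite addrC subr_eq0; apply/eqP.
apply: eq_big => [Y|Y /andP[sXY neq]]; first by rewrite eq_sym.
rewrite eq_sym in neq; have := dimv_proper sXY neq; have := dimv_le_row Y => ? ?.
by apply: mu_fuel_stable; lia.
Qed.

Lemma inter_of_Lat A (B : {set 'I_(size A)}) : inter_of B \in Lat A.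
Proof. by rewrite mem_undup; apply: map_f; rewrite mem_enum. Qed.

(** The smallest flat through [v]. *)
Definition flat_at A (v : 'rV[F]_l) : {vspace 'rV[F]_l} :=
  inter_of [set i : 'I_(size A) | v \in nth 0%VS A i].

Lemma flat_at_min A v X : X \in Lat A -> (flat_at A v <= X)%VS = (v \in X).
Proof.
rewrite mem_undup => /mapP[B _ ->]; apply/idP/idP.
  move/subvP; apply; rewrite memvE; apply/subv_bigcapP => i.
  by rewrite inE -memvE.
rewrite memvE => /subv_bigcapP vB; apply/subv_bigcapP => i iB.
by apply: bigcapv_inf (subvv _); rewrite inE memvE vB.
Qed.

Lemma flat_at_full A v : all (fun H => H != fullv) A ->
  (flat_at A v == fullv) = ~~ has (fun H : {vspace _} => v \in H) A.
Proof.
move=> /allP nA; rewrite eqEsubv subvf /=; apply/subv_bigcapP/hasPn => [vA H HA|vA i].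
  have iH : (index H A < size A)%N by rewrite index_mem.
  apply/negP => vH; have := vA (Ordinal iH).
  rewrite inE /= nth_index // vH => /(_ isT) fH.
  by have := nA H HA; rewrite eqEsubv subvf fH.
by rewrite inE (negPf (vA _ (mem_nth _ _))).
Qed.

End CharPoly.

(* Crapo--Rota: q^dim X counts the points of X, and summing mu over the flats
   through v is summing it above the smallest such flat. *)
Lemma charpoly_card (F : finFieldType) (l : nat) (A : seq {vspace 'rV[F]_l}) :
  all (fun H => H != fullv) A ->
  (arr_charpoly A).[(#|F|)%:Z] =
    (#|[pred v : 'rV[F]_l | ~~ has (fun H : {vspace _} => v \in H) A]|)%:Z.
Proof.
move=> nA; rewrite /arr_charpoly horner_sum.
under eq_bigr => X _.
  rewrite !hornerE /=.
  have -> : (#|F|%:Z) ^+ \dim X = \sum_(v | v \in X) 1.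
    by rewrite -(natz #|F|) -natrX -card_vspace sumr_const.
  rewrite mulr_sumr big_mkcond /=.
over.
rewrite exchange_big /= -natz -sumr_const [RHS]big_mkcond /=.
apply: eq_bigr => v _; rewrite -big_mkcond /=.
transitivity (\sum_(X <- Lat A | (flat_at A v <= X)%VS) mobius A X).
  rewrite [LHS]big_seq_cond [RHS]big_seq_cond.
  apply: eq_big => [X|X _]; last by rewrite mulr1.
  by case XL: (X \in _) => //=; rewrite flat_at_min.
rewrite sum_mobius_above ?inter_of_Lat // flat_at_full // inE.
by case: ifP.
Qed.

(** * Power functions on a finite field *)

Lemma card_finField_gt1 (F : finFieldType) : (1 < #|F|)%N.
Proof. exact: finNzRing_gt1. Qed.

Section ReducedExponent.
Variable F : finFieldType.
Local Notation q := #|F|.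

(* The exponent in [0, q-1] defining the same function on F; positive exponents
   stay positive, so that 0 ^ a is respected. *)
Definition red_exp (a : nat) : nat := if a is b.+1 then (b %% q.-1).+1 else 0.

Lemma red_exp_lt a : (red_exp a < q)%N.
Proof.
have q1 : (1 < q)%N := card_finField_gt1 F.
case: a => [|a]; rewrite /red_exp; first exact: ltnW.
have q0 : (0 < q.-1)%N by lia.
by have := ltn_pmod a q0; lia.
Qed.

(** Blocks of q-1 are dropped one at a time by x^q = x, a positive exponent always remaining. *)
Lemma exprf_red_exp (x : F) a : x ^+ red_exp a = x ^+ a.
Proof.
case: a => [|a] //=; rewrite [in RHS](divn_eq a q.-1).
elim: (a %/ _)%N => [|k IH]; first by rewrite mul0n add0n.
rewrite {}IH mulSn -addnA -[in RHS]addnS exprD [in RHS]exprS mulrA -exprSr.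
by rewrite (ltn_predK (card_finField_gt1 F)) expf_card -exprS.
Qed.

(** Zero is alone in its class, and two positive exponents share a class only if they are congruent
    modulo q-1. *)
Lemma red_exp_gap a b :
  red_exp a = red_exp b -> (b < a)%N -> (0 < b)%N /\ (b + q.-1 <= a)%N.
Proof.
case: a b => [|a] [|b] //= [] e ab; split => //.
rewrite addSn ltnS (divn_eq a q.-1) (divn_eq b q.-1) e.
rewrite -addnA [(_ %% _ + _)%N]addnC addnA leq_add2r -mulSnr leq_mul2r.
apply/orP; right; rewrite ltnNge; apply/negP => le.
have: (a <= b)%N.
  by rewrite (divn_eq a q.-1) (divn_eq b q.-1) e leq_add2r leq_mul2r le orbT.
lia.
Qed.

Lemma red_exp_addl a : (0 < a)%N -> red_exp (a + q.-1) = red_exp a.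
Proof. by case: a => // a _; rewrite addSn /= modnDr. Qed.

(* Inverting the Vandermonde matrix of all the elements of F. *)
Lemma dual_powers : exists w : 'I_q -> F -> F,
  forall a (k : nat), \sum_x w a x * x ^+ k = (red_exp k == a)%:R.
Proof.
pose V := Vandermonde q (\row_(j < q) (enum_val j : F)).
have Vu : V \in unitmx.
  rewrite unitmxE det_Vandermonde unitfE; apply/prodf_neq0 => i _.
  apply/prodf_neq0 => j ij; rewrite !mxE subr_eq0 (inj_eq enum_val_inj).
  by apply: contraTneq ij => ->; rewrite ltnn.
exists (fun a x => invmx V (enum_rank x) a) => a k.
under eq_bigr do rewrite -exprf_red_exp.
have := congr1 (fun M : 'M__ => M (Ordinal (red_exp_lt k)) a) (mulmxV Vu).
rewrite !mxE -(inj_eq val_inj) /= => <-.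
rewrite (reindex (enum_val : 'I_q -> F)) /=; last first.
  by apply: onW_bij; apply: enum_val_bij.
by apply: eq_bigr => j _; rewrite !mxE enum_valK mulrC.
Qed.

(** Summing the values of [f] over F^n against a product of dual weights, one for each coordinate,
    isolates the monomials whose reduced exponents are [r]. *)
Lemma vanishing_class_sum n (f : {mpoly F[n]}) (r : {ffun 'I_n -> 'I_q}) :
  (forall v, f.@[v] = 0) ->
  \sum_(m <- msupp f | [forall i, red_exp (m i) == r i]) f@_m = 0.
Proof.
move=> f0; have [w wE] := dual_powers.
transitivity (\sum_(v : {ffun 'I_n -> F}) (\prod_i w (r i) (v i)) * f.@[v]).
  2: by rewrite big1 // => v _; rewrite f0 mulr0.
under [RHS]eq_bigr do rewrite mevalE mulr_sumr.
rewrite exchange_big /= [LHS]big_mkcond; apply: eq_bigr => m _ /=.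
under [RHS]eq_bigr do rewrite mulrCA -big_split /=.
rewrite -mulr_sumr.
rewrite -(bigA_distr_bigA (fun i x => w (r i) x * x ^+ m i)) /=.
under [in RHS]eq_bigr do rewrite wE.
case: ifP => [/forallP mr|/forallPn [i /negPf mr]].
  by rewrite big1 ?mulr1 // => i _; rewrite mr.
by rewrite (bigD1 i) //= mr mul0r mulr0.
Qed.

End ReducedExponent.

(** * Homogeneous polynomials vanishing at every point of F^n *)

Section VanishingIdeal.
Variables (F : finFieldType) (n : nat).
Local Notation q := #|F|.
Local Notation S := {mpoly F[n]}.

Definition frob_minor (i j : 'I_n) : S := 'X_i * 'X_j ^+ q - 'X_j * 'X_i ^+ q.

(** Membership in the ideal of the minors, with the degree of the coefficients recorded: it becomes
    the third exponent. *)
Definition frob_comb (e : nat) (f : S) : Prop :=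
  exists2 g : 'I_n -> 'I_n -> S, (forall i j, g i j \is e.-homog)
    & f = \sum_i \sum_j g i j * frob_minor i j.

Lemma frob_comb0 e : frob_comb e 0.
Proof.
exists (fun _ _ => 0) => [*|]; first exact: dhomog0.
by rewrite big1 // => i _; rewrite big1 // => j _; rewrite mul0r.
Qed.

Lemma frob_combD e f1 f2 : frob_comb e f1 -> frob_comb e f2 -> frob_comb e (f1 + f2).
Proof.
move=> [g1 h1 ->] [g2 h2 ->]; exists (fun i j => g1 i j + g2 i j) => [i j|].
  exact: dhomogD.
rewrite -big_split; apply: eq_bigr => i _; rewrite -big_split.
by apply: eq_bigr => j _; rewrite mulrDl.
Qed.

Lemma frob_combZ e c f : frob_comb e f -> frob_comb e (c *: f).
Proof.
move=> [g h ->]; exists (fun i j => c *: g i j) => [i j|]; first exact: dhomogZ.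
rewrite scaler_sumr; apply: eq_bigr => i _; rewrite scaler_sumr.
by apply: eq_bigr => j _; rewrite scalerAl.
Qed.

Lemma frob_comb_minor e (p : S) (i j : 'I_n) :
  p \is e.-homog -> frob_comb e (p * frob_minor i j).
Proof.
move=> hp; exists (fun a b => if (a == i) && (b == j) then p else 0) => [a b|].
  by case: ifP => // _; apply: dhomog0.
rewrite (bigD1 i) //= [X in _ = _ + X]big1 ?addr0 => [|a /negPf na].
  2: by rewrite big1 // => b _; rewrite na /= mul0r.
rewrite (bigD1 j) //= !eqxx big1 ?addr0 // => b /negPf nb.
by rewrite nb mul0r.
Qed.

(** Monomials of equal degree that induce the same function on F^n. *)
Definition same_red (m1 m2 : 'X_{1..n}) : Prop :=
  mdeg m1 = mdeg m2 /\ forall i, red_exp F (m1 i) = red_exp F (m2 i).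

Lemma mnm_lt_exists (m1 m2 : 'X_{1..n}) :
  mdeg m1 = mdeg m2 -> m1 != m2 -> exists i, (m2 i < m1 i)%N.
Proof.
move=> dm neq; apply/existsP; apply: contraNT neq => /existsPn le.
have {}le i : (m1 i <= m2 i)%N by have := le i; rewrite -leqNgt.
apply/eqP/mnmP => i; apply/eqP; rewrite eqn_leq le /=.
move: dm; rewrite !mdegE (bigD1 i) //= [RHS](bigD1 i) //= => dm.
rewrite -(leq_add2r (\sum_(j < n | j != i) m2 j)) -dm leq_add2l.
exact: leq_sum.
Qed.

(** Equal degrees force one exponent to go down and another to go up; [red_exp_gap] makes both
    changes at least q-1. *)
Lemma same_red_move (m1 m2 : 'X_{1..n}) : same_red m1 m2 -> m1 != m2 ->
  exists i j, [/\ i != j, (m2 i + q.-1 <= m1 i)%N, (0 < m2 i)%N,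
                  (m1 j + q.-1 <= m2 j)%N & (0 < m1 j)%N].
Proof.
move=> [dm rm] neq; have [i lti] := mnm_lt_exists dm neq.
have neq' : m2 != m1 by rewrite eq_sym.
have [j ltj] := mnm_lt_exists (esym dm) neq'.
have [? ?] := red_exp_gap (rm i) lti.
have [? ?] := red_exp_gap (esym (rm j)) ltj.
by exists i, j; split => //; apply: contraTneq lti => ->; lia.
Qed.

(** Some exponent of [m1] is at least q, and another is at least 1. *)
Lemma same_red_deg (m1 m2 : 'X_{1..n}) :
  same_red m1 m2 -> m1 != m2 -> (q.+1 <= mdeg m1)%N.
Proof.
move=> sr neq; have [i [j [ij h1 h2 h3 h4]]] := same_red_move sr neq.
have q1 : (1 < q)%N := card_finField_gt1 F.
set Q := #|F| in h1 h3 q1 *.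
by rewrite mdegE (bigD1 i) //= (bigD1 j) 1?eq_sym //=; lia.
Qed.

(** Modulo a minor, x_j x_i^q may be traded for x_i x_j^q, which moves q-1 units of exponent from i
    to j. Induction on the total excess of [m1] over [m2]. *)
Lemma same_red_comb e (m1 m2 : 'X_{1..n}) : same_red m1 m2 ->
  (e + q.+1)%N = mdeg m1 -> frob_comb e ('X_[m1] - 'X_[m2]).
Proof.
have q1 : (1 < q)%N := card_finField_gt1 F.
have [k] := ubnP (\sum_i (m1 i - m2 i))%N; elim: k m1 => // k IH m1 lek sr de.
have [->|neq] := eqVneq m1 m2; first by rewrite subrr; apply: frob_comb0.
have [i [j [ij hi1 hi2 hj1 hj2]]] := same_red_move sr neq.
set Q := #|F| in q1 de hi1 hj1 *.
(* The cofactor of x_j x_i^q in [m1]; below, [m3] is the monomial after the trade. *)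
pose m0 := [multinom if a == i then (m1 a - Q)%N else if a == j then (m1 a).-1
             else m1 a | a < n].
have Em1 : m1 = (m0 + U_(i) *+ Q + U_(j))%MM.
  apply/mnmP => a; rewrite !mnmDE mulmnE !mnm1E mnmE ![_ == a]eq_sym.
  by case: (eqVneq a i) => [->|_]; [rewrite (negPf ij)|case: eqVneq => [->|_]] => /=;
    lia.
pose m3 := (m0 + U_(i) + U_(j) *+ Q)%MM.
have d3 : mdeg m3 = mdeg m1 by rewrite Em1 !mdegD !mdegMn !mdeg1; lia.
have Em3 a : m3 a = if a == i then (m1 a - Q.-1)%N else if a == j then (m1 a + Q.-1)%N
             else m1 a.
  rewrite !mnmDE mulmnE !mnm1E mnmE ![_ == a]eq_sym.
  by case: (eqVneq a i) => [->|_]; [rewrite (negPf ij)|case: eqVneq => [->|_]] => /=;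
    lia.
have -> : 'X_[m1] - 'X_[m2] =
    'X_[m0] * ('X_j * 'X_i ^+ Q - 'X_i * 'X_j ^+ Q) + ('X_[m3] - 'X_[m2]) :> S.
  rewrite Em1 /m3 !mpolyXD !mpolyXn; ring.
apply: frob_combD.
  apply: frob_comb_minor; rewrite dhomogX; apply/eqP.
  change (mdeg m0 = e); move: de; rewrite Em1 !mdegD !mdegMn !mdeg1; lia.
apply: IH; last by rewrite d3.
(* The excess drops by q-1 at i, and none appears at j since [m1 j + q.-1 <= m2 j]. *)
- move: lek; rewrite ltnS; apply: leq_trans.
  rewrite (bigD1 i) //= [X in (_ < X)%N](bigD1 i) //=.
  rewrite Em3 eqxx -addSn; apply: leq_add; first by lia.
  by apply: leq_sum => a /negPf na; rewrite Em3 na; case: eqP => [->|_]; lia.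
- split=> [|a]; first by rewrite d3; case: sr.
  rewrite -(sr.2 a) Em3; case: eqVneq => [->|_]; last case: eqVneq => [->|_] //.
    by rewrite -[in RHS](@subnK Q.-1 (m1 i)) ?red_exp_addl //; lia.
  by rewrite red_exp_addl.
Qed.

(* Group the monomials of f by residual exponents: within a class they all agree
   modulo the minors, and the coefficients of a class add up to zero. *)
Lemma vanishing_frob_comb d (f : S) : f \is d.-homog -> f != 0 ->
  (forall v, f.@[v] = 0) -> exists2 e, (e + q.+1)%N = d & frob_comb e f.
Proof.
move=> /dhomogP hf fn0 f0.
pose r (m : 'X_{1..n}) : {ffun 'I_n -> 'I_q} :=
  [ffun i => Ordinal (red_exp_lt F (m i))].
(* The first monomial of the support in class [c]; the default is never reached for the class of a
   monomial of the support. *)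
pose rep (c : {ffun 'I_n -> 'I_q}) :=
  nth 0%MM (msupp f) (find (fun m => r m == c) (msupp f)).
have repP m : m \in msupp f -> same_red m (rep (r m)).
  move=> mf; have hs : has (fun m' => r m' == r m) (msupp f) by apply/hasP; exists m.
  have /eqP/ffunP re := nth_find 0%MM hs.
  split=> [|i]; first by rewrite !hf // mem_nth // -has_find.
  by have := congr1 val (re i); rewrite !ffunE.
have Ef : f = \sum_(m <- msupp f) f@_m *: ('X_[m] - 'X_[rep (r m)]).
  under eq_bigr do rewrite scalerBr; rewrite sumrB -mpolyE.
  rewrite (partition_big r xpredT) //= [X in _ - X]big1 ?subr0 // => c _.
  under eq_bigr => m /eqP -> do [].
  rewrite -scaler_suml (_ : \sum_(m <- msupp f | _) f@_m = 0) ?scale0r //.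
  rewrite -[RHS](vanishing_class_sum c f0); apply: eq_bigl => m.
  apply/eqP/forallP => [<- i|h]; first by rewrite ffunE.
  by apply/ffunP => i; apply/val_inj; rewrite ffunE; apply/eqP/h.
(* If every monomial represents itself, [Ef] gives f = 0. Otherwise two distinct monomials share a
   class, whence d >= q+1. *)
have [all0|/allPn [m mf neq]] := boolP (all (fun m => m == rep (r m)) (msupp f)).
  case/eqP: fn0; rewrite Ef big_seq big1 // => m mf.
  by rewrite -(eqP (allP all0 m mf)) subrr scaler0.
have dq : (q.+1 <= d)%N by rewrite -(hf m mf); apply: same_red_deg (repP m mf) neq.
exists (d - q.+1)%N; first by rewrite subnK.
rewrite Ef big_seq; apply: (big_ind (frob_comb _)).
- exact: frob_comb0.
- by move=> *; apply: frob_combD.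
move=> m' m'f; apply/frob_combZ/same_red_comb; first exact: repP.
by rewrite subnK // (hf _ m'f).
Qed.

End VanishingIdeal.

(** * Linear forms, their prime ideals, and hyperplanes *)

Section LinearForms.
Variables (F : fieldType) (l : nat).
Local Notation V := 'rV[F]_l.
Local Notation S := {mpoly F[l]}.
Implicit Types (a b : V) (p g : S) (H : {vspace V}).

Lemma meval_lin_form a (v : 'I_l -> F) :
  (lin_form a).@[v] = \sum_i v i * a 0 i.
Proof.
rewrite /lin_form raddf_sum; apply: eq_bigr => i _ /=.
by rewrite mevalZ mevalXU mulrC.
Qed.

Lemma mem_defines a H (v : V) : defines a H ->
  (v \in H) = ((lin_form a).@[fun i => v 0 i] == 0).
Proof. by move=> aH; rewrite aH meval_lin_form. Qed.

Lemma lin_form_homog a : lin_form a \is 1.-homog.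
Proof.
apply: rpred_sum => i _; apply: dhomogZ.
by rewrite dhomogX; apply/eqP/mdeg1.
Qed.

(* The substitution eliminating the variable k by means of a = 0. Its kernel is
   the ideal of lin_form a, which is therefore prime. *)
Definition proj_lin a (k : 'I_l) : S -> S :=
  comp_mpoly [tuple if i == k then 'X_i - (a 0 k)^-1 *: lin_form a else 'X_i
             | i < l].

HB.instance Definition _ a k :=
  GRing.LRMorphism.copy (proj_lin a k) (comp_mpoly _).

Lemma proj_linX a k i : i != k -> proj_lin a k 'X_i = 'X_i.
Proof.
by move=> /negPf ik; rewrite /proj_lin comp_mpolyXU -tnth_nth tnth_mktuple ik.
Qed.

Lemma proj_linXk a k : proj_lin a k 'X_k = 'X_k - (a 0 k)^-1 *: lin_form a.
Proof.
by rewrite /proj_lin comp_mpolyXU -tnth_nth tnth_mktuple eqxx.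
Qed.

Lemma proj_lin_form a k : a 0 k != 0 -> proj_lin a k (lin_form a) = 0.
Proof.
move=> ak; rewrite {1}/lin_form raddf_sum (bigD1 k) //= linearZ /= proj_linXk.
under eq_bigr => i ik do rewrite linearZ /= proj_linX //.
rewrite scalerBr scalerA divff // scale1r addrAC.
by rewrite -(bigD1 k (P := xpredT) (F := fun i => a 0 i *: 'X_i)) //= subrr.
Qed.

(** The property holds for variables and passes to products, scalar multiples and sums. *)
Lemma proj_lin_mod a k p : exists g, p - proj_lin a k p = lin_form a * g.
Proof.
pose P p := exists g, p - proj_lin a k p = lin_form a * g.
have PM p1 p2 : P p1 -> P p2 -> P (p1 * p2).
  move=> [g1 e1] [g2 e2]; exists (g1 * p2 + proj_lin a k p1 * g2).
  rewrite rmorphM /= mulrDr mulrA -e1 mulrCA -e2.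
  by rewrite mulrBl mulrBr addrA subrK.
have PX i : P 'X_i.
  have [->|ik] := eqVneq i k.
    exists ((a 0 k)^-1 *: 1); rewrite proj_linXk opprB addrC subrK.
    by rewrite -scalerAr mulr1.
  by exists 0; rewrite proj_linX // subrr mulr0.
have P1 : P 1 by exists 0; rewrite rmorph1 subrr mulr0.
suff: P p by [].
rewrite (mpolyE p); apply: (big_ind P) => [|p1 p2 [g1 e1] [g2 e2]|m _].
- by exists 0; rewrite raddf0 subrr mulr0.
- by exists (g1 + g2); rewrite raddfD /= mulrDr -e1 -e2 opprD addrACA.
have [g e] : P 'X_[m].
  rewrite mpolyXE_id; apply: (big_ind P P1 PM) => i _.
  elim: (m i) => [|n IH]; first by rewrite expr0.
  by rewrite exprS; exact: PM (PX i) IH.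
by exists (p@_m *: g); rewrite linearZ /= -scalerBr e scalerAr.
Qed.

Lemma lin_form_dvdP a k p : a 0 k != 0 ->
  (exists g, p = lin_form a * g) <-> proj_lin a k p = 0.
Proof.
move=> ak; split=> [[g ->]|p0].
  by rewrite rmorphM /= proj_lin_form // mul0r.
by have [g] := proj_lin_mod a k p; rewrite p0 subr0 => ->; exists g.
Qed.

Lemma rV_neq0P a : a != 0 -> exists k, a 0 k != 0.
Proof. by move/rV0Pn. Qed.

Lemma defines_neq0 a H : (0 < l)%N -> is_hyperplane H -> defines a H -> a != 0.
Proof.
move=> l0 /eqP dH aH; apply/eqP => a0.
have : (fullv <= H)%VS.
  apply/subvP => v _; rewrite aH a0 big1 // => i _.
  by rewrite mxE mulr0.
by move/dimvS; rewrite dH dimv_rVf; lia.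
Qed.

Lemma hyperplane_form H : (0 < l)%N -> is_hyperplane H ->
  exists a : V, defines a H.
Proof.
move=> l0 /eqP dH.
have dC : \dim (H^C)%VS = 1%N by rewrite dimv_compl dH dimv_rVf; lia.
pose w := vpick (H^C)%VS.
have w0 : w != 0 by rewrite vpick0 -dimv_eq0 dC.
have CE : (H^C)%VS = <[w]>%VS.
  by apply/esym/eqP; rewrite eqEdim dC dim_vline w0 andbT -memvE memv_pick.
have [k wk] := rV_neq0P w0.
(* The projection along H onto the line spanned by [w]; its vanishing is detected by a coordinate k
   at which [w] is nonzero. *)
pose f := (\1 - projv H)%VF.
have fE v : f v = v - projv H v by rewrite add_lfunE opp_lfunE id_lfunE.
exists (\row_i (f (delta_mx 0 i)) 0 k) => v.
transitivity (f v == 0).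
  rewrite fE subr_eq0; apply/idP/eqP => [vH|->]; first by rewrite projv_id.
  exact: memv_proj.
transitivity ((f v) 0 k == 0).
  have: f v \in <[w]>%VS by rewrite -CE fE memv_projC.
  case/vlineP=> c ->; rewrite mxE mulf_eq0 (negPf wk) orbF.
  by rewrite scaler_eq0 (negPf w0) orbF.
rewrite {1}(row_sum_delta v) linear_sum summxE; congr (_ == _).
by apply: eq_bigr => i _; rewrite linearZ /= !mxE.
Qed.

Lemma lin_form_dvd_hyperplane a b H H' : is_hyperplane H -> is_hyperplane H' ->
  defines a H -> defines b H' -> (exists g, lin_form b = lin_form a * g) -> H = H'.
Proof.
move=> /eqP dH /eqP dH' aH bH' [g bg]; apply/eqP; rewrite eqEdim dH dH' leqnn andbT.
apply/subvP => v; rewrite (mem_defines _ aH) (mem_defines _ bH') bg mevalM.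
by move/eqP ->; rewrite mul0r.
Qed.

Lemma defines_proportional a b H : b != 0 -> defines a H -> defines b H ->
  exists c, b = c *: a.
Proof.
move=> b0 aH bH; have [k bk] := rV_neq0P b0.
pose A (v : V) := \sum_i v 0 i * a 0 i; pose B (v : V) := \sum_i v 0 i * b 0 i.
have dE (c : V) i : \sum_j (delta_mx 0 i : V) 0 j * c 0 j = c 0 i.
  rewrite (bigD1 i) //= mxE !eqxx mul1r big1 ?addr0 // => j /negPf ji.
  by rewrite mxE ji andbF mul0r.
have ak : a 0 k != 0 by rewrite -dE -aH bH dE.
exists (b 0 k / a 0 k); apply/rowP => i; rewrite mxE.
(* Chosen in the kernel of [a], hence of [b], which gives b_i = (a_i / a_k) b_k. *)
pose v : V := delta_mx 0 i - (a 0 i / a 0 k) *: delta_mx 0 k.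
have lE (c : V) : \sum_j v 0 j * c 0 j = c 0 i - a 0 i / a 0 k * c 0 k.
  rewrite -[in RHS](dE c i) -[in RHS](dE c k) mulr_sumr -sumrB.
  by apply: eq_bigr => j _; rewrite !mxE mulrBl mulrA.
have : v \in H by rewrite aH lE divfK // subrr.
rewrite bH lE subr_eq0 => /eqP ->.
by rewrite mulrAC [a 0 i * _]mulrC -mulrA mulrAC mulrA mulrAC.
Qed.

Lemma lin_formZ c a : lin_form (c *: a) = c *: lin_form a.
Proof.
by rewrite /lin_form scaler_sumr; apply: eq_bigr => i _; rewrite mxE scalerA.
Qed.

(** Each form is prime and divides no other form of the list, so it must divide the quotient left by
    the others. *)
Lemma prod_lin_form_dvd (I : eqType) (r : seq I) (al : I -> V) p :
  uniq r -> (forall i, i \in r -> al i != 0) ->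
  {in r &, forall i j, (exists g, lin_form (al j) = lin_form (al i) * g) -> i = j} ->
  (forall i, i \in r -> exists g, p = lin_form (al i) * g) ->
  exists g, p = (\prod_(i <- r) lin_form (al i)) * g.
Proof.
elim: r => [|i r IH] /=; first by exists p; rewrite big_nil mul1r.
move=> /andP[ir ur] nz cop dvd.
have [|j k jr kr|j jr|g pg] := IH ur.
- by move=> j jr; apply: nz; rewrite inE jr orbT.
- by apply: cop; rewrite inE ?jr ?kr orbT.
- by apply: dvd; rewrite inE jr orbT.
have [k ik] := rV_neq0P (nz i (mem_head _ _)).
have := (lin_form_dvdP p ik).1 (dvd i (mem_head _ _)).
rewrite pg rmorphM /= => /eqP; rewrite mulf_eq0 => /orP[|/eqP g0]; last first.
  have [g' ->] := (lin_form_dvdP g ik).2 g0.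
  by exists g'; rewrite big_cons mulrA [_ * lin_form _]mulrC.
rewrite rmorph_prod prodf_seq_eq0 => /hasP[j jr /= /eqP].
move/(lin_form_dvdP _ ik) => /cop ij.
by move: ir; rewrite ij ?jr // inE ?eqxx ?jr ?orbT.
Qed.

(** Modulo the form, M kills the nonzero constant column [a]; multiplying by the adjugate shows that
    its determinant vanishes there. *)
Lemma lin_form_dvd_det a (M : 'M[S]_l) : a != 0 ->
  (forall j, exists g, der_apply (M j) a = lin_form a * g) ->
  exists g, \det M = lin_form a * g.
Proof.
move=> a0 dvd; have [k ak] := rV_neq0P a0; apply/(lin_form_dvdP _ ak).
pose c : 'cV[S]_l := \col_i (a 0 i)%:MP.
have Mc : map_mx (proj_lin a k) M *m c = 0.
  apply/colP => j; rewrite !mxE.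
  rewrite -[RHS]((lin_form_dvdP _ ak).1 (dvd j)) /der_apply raddf_sum.
  by apply: eq_bigr => i _; rewrite /= linearZ /= !mxE mulrC mul_mpolyC.
have := congr1 (mulmx (\adj (map_mx (proj_lin a k) M))) Mc.
rewrite mulmxA mul_adj_mx mulmx0 mul_scalar_mx det_map_mx => /colP /(_ k).
rewrite !mxE => /eqP; rewrite mulf_eq0 => /orP[/eqP //|].
by rewrite mpolyC_eq0 (negPf ak).
Qed.

End LinearForms.

(** * The defining polynomial and Saito's criterion *)

Section Saito.
Variables (F : fieldType) (l : nat) (A : seq {vspace 'rV[F]_l}).
Local Notation S := {mpoly F[l]}.
Hypothesis l_gt0 : (0 < l)%N.
Hypothesis arrA : is_arrangement A.

Variable al : 'I_(size A) -> 'rV[F]_l.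
Hypothesis alP : forall i, defines (al i) (nth 0%VS A i).

Let hyp i : is_hyperplane (nth 0%VS A (i : 'I_(size A))).
Proof. by case/andP: arrA => _ /allP; apply; apply: mem_nth. Qed.

Let al0 i : al i != 0.
Proof. exact: defines_neq0 l_gt0 (hyp i) (alP i). Qed.

Definition def_poly : S := \prod_i lin_form (al i).

Lemma def_poly_dvd_det (M : 'M[S]_l) :
  (forall j, in_DA A (M j)) -> exists g, \det M = def_poly * g.
Proof.
move=> MA; apply: prod_lin_form_dvd => [|i _|i j _ _|i _].
- exact: index_enum_uniq.
- exact: al0.
- move/(lin_form_dvd_hyperplane (hyp i) (hyp j) (alP i) (alP j))/eqP.
  by rewrite nth_uniq //; [move/eqP/val_inj | case/andP: arrA].
by apply: lin_form_dvd_det => // j; apply: MA (alP i); apply: mem_nth.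
Qed.

(** [in_DA] ranges over all forms defining H, so an arbitrary one is compared with the chosen
    [al]. *)
Lemma lin_form_dvd_def_poly H a : H \in A -> defines a H ->
  exists g, def_poly = lin_form a * g.
Proof.
move=> HA aH; have iA : (index H A < size A)%N by rewrite index_mem.
have := alP (Ordinal iA); rewrite /= nth_index // => alH.
have [c e] := defines_proportional (al0 _) aH alH.
rewrite /def_poly (bigD1 (Ordinal iA)) //= {1}e lin_formZ.
by eexists; rewrite -scalerAl scalerAr.
Qed.

Lemma def_poly_neq0 : def_poly != 0.
Proof.
apply/prodf_neq0 => i _; have [k ak] := rV_neq0P (al0 i).
apply/eqP => /(congr1 (meval (fun j => (j == k)%:R))).
rewrite meval_lin_form meval0 (bigD1 k) //= eqxx mul1r big1.
  by rewrite addr0; apply/eqP.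
by move=> j /negPf ->; rewrite mul0r.
Qed.

Lemma def_poly_homog : def_poly \is (size A).-homog.
Proof.
have: def_poly \is (\sum_(i < size A) 1)%N.-homog.
  apply: (big_ind2 (fun (p : S) n => p \is n.-homog)) => [|p m p' m'|i _].
  - exact: dhomog1.
  - exact: dhomogM.
  exact: lin_form_homog.
by rewrite sum1_card card_ord.
Qed.

Lemma saito_criterion (M : 'M[S]_l) (d : 'I_l -> nat) :
  (forall j, in_DA A (M j)) -> (forall j, homog_der (d j) (M j)) ->
  \det M = def_poly -> free_with_exponents A d.
Proof.
move=> MA Mh dM; exists (fun j i => M j i); split=> //.
  move=> delta dA.
  (* Cramer's rule: the j-th coefficient of [delta] is the determinant of M with row j replaced by
     [delta], divided by [def_poly]. *)
  pose N j : 'M[S]_l := \matrix_(i, k) if i == j then delta k else M i k.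
  have NA j i : in_DA A (N j i).
    move=> H HA a aH; case: (eqVneq i j) => [ij|ij].
      have [g e] := dA H HA a aH; exists g; rewrite -e.
      by apply: eq_bigr => k _; rewrite mxE ij eqxx.
    have [g e] := MA i H HA a aH; exists g; rewrite -e.
    by apply: eq_bigr => k _; rewrite mxE (negPf ij).
  have [f fE] := fin_all_exists (fun j => def_poly_dvd_det (NA j)).
  exists f => i; apply: (mulfI def_poly_neq0).
  pose D : 'rV[S]_l := \row_k delta k.
  have := congr1 (fun B : 'rV_l => B 0 i) (mulmxA D (\adj M) M).
  rewrite mul_adj_mx mul_mx_scalar !mxE dM => ->.
  rewrite mulr_sumr; apply: eq_bigr => j _; rewrite mulrA -fE.
  have cof k : cofactor (N j) j k = cofactor M j k.
    have rowN : row' j (col' k (N j)) = row' j (col' k M).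
      by apply/matrixP => x y; rewrite !mxE eq_sym (negPf (neq_lift _ _)).
    by rewrite /cofactor rowN.
  rewrite (expand_det_row _ j) mxE; congr (_ * _).
  by apply: eq_bigr => k _; rewrite cof !mxE eqxx.
move=> f f0 j; pose D : 'rV[S]_l := \row_k f k.
have DM : D *m M = 0.
  by apply/rowP => i; rewrite !mxE -[RHS](f0 i); apply: eq_bigr => k _; rewrite mxE.
have := congr1 (fun B => (B *m \adj M) 0 j) DM.
rewrite -mulmxA mul_mx_adj mul_mx_scalar mul0mx dM !mxE => /eqP.
by rewrite mulf_eq0 (negPf def_poly_neq0) => /eqP.
Qed.

End Saito.

(** * Cross products and determinants in dimension three *)

Lemma addI3E (k : 'I_3) :
  ((k + 1 + 1 = k + 2%:R)%R * (k + 1 + 2%:R = k)%R *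
   (k + 2%:R + 1 = k)%R * (k + 2%:R + 2%:R = k + 1)%R)%type.
Proof.
by do ![split]; apply/val_inj; case: k => [[|[|[|]]]].
Qed.

Section CrossProduct.
Variable R : comNzRingType.
Implicit Types a E G T : 'I_3 -> R.

(* Indices in 'I_3 are added modulo 3. *)
Definition cross E G (k : 'I_3) : R :=
  E (k + 1) * G (k + 2%:R) - E (k + 2%:R) * G (k + 1).

Lemma sum_I3 (f : 'I_3 -> R) (k : 'I_3) : \sum_i f i = f k + f (k + 1) + f (k + 2%:R).
Proof.
rewrite (reindex (fun i => k + i)) /=; last first.
  by exists (fun i => - k + i) => i _; rewrite ?addKr ?addNKr.
rewrite !big_ord_recl big_ord0 !addr0 addrA.
by congr (_ + _ + _); congr (f (k + _)); apply/val_inj.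
Qed.

(** Off-diagonal pairs are grouped by the index k that they omit. *)
Lemma sum_I3_pairs (h : 'I_3 -> 'I_3 -> R) :
  \sum_i \sum_j h i j =
  \sum_k (h k k + h (k + 1) (k + 2%:R) + h (k + 2%:R) (k + 1)).
Proof.
under eq_bigr => i _ do rewrite (sum_I3 _ i).
rewrite !big_split /=; congr (_ + _ + _).
  rewrite (reindex (fun k => k + 1)) /=; last first.
    by exists (fun k => k - 1) => i _; rewrite ?addrK ?subrK.
  by apply: eq_bigr => k _; rewrite addI3E.
rewrite (reindex (fun k => k + 2%:R)) /=; last first.
  by exists (fun k => k - 2%:R) => i _; rewrite ?addrK ?subrK.
by apply: eq_bigr => k _; rewrite addI3E.
Qed.

Lemma cross_annihilates a E G T (k : 'I_3) :
  \sum_i a i * E i = 0 -> \sum_i a i * G i = 0 -> \sum_i T i * cross E G i = 0 ->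
  (\sum_i a i * T i) * cross E G k = 0.
Proof.
rewrite !(sum_I3 _ k) /cross !addI3E.
set i := k + 1; set j := k + 2%:R.
move: (a k) (a i) (a j) (E k) (E i) (E j) (G k) (G i) (G j) (T k) (T i) (T j).
move=> a0 a1 a2 E0 E1 E2 G0 G1 G2 T0 T1 T2 hE hG hT.
transitivity (a0 * (T0 * (E1 * G2 - E2 * G1) + T1 * (E2 * G0 - E0 * G2)
    + T2 * (E0 * G1 - E1 * G0))
  + T1 * (G2 * (a0 * E0 + a1 * E1 + a2 * E2) - E2 * (a0 * G0 + a1 * G1 + a2 * G2))
  + T2 * (E1 * (a0 * G0 + a1 * G1 + a2 * G2) - G1 * (a0 * E0 + a1 * E1 + a2 * E2))).
  by ring.
by rewrite hE hG hT; ring.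
Qed.

Lemma det_nat3 (f : nat -> nat -> R) :
  \det (\matrix_(i < 3, j < 3) f i j) =
    f 2 0 * (f 0 1 * f 1 2 - f 0 2 * f 1 1) + f 2 1 * (f 0 2 * f 1 0 - f 0 0 * f 1 2)
    + f 2 2 * (f 0 0 * f 1 1 - f 0 1 * f 1 0).
Proof.
rewrite (expand_det_row _ ord_max) !big_ord_recl big_ord0 /cofactor.
rewrite !(expand_det_row _ ord0) !big_ord_recl !big_ord0 /cofactor !det_mx11 !mxE /=.
rewrite /bump /=; ring.
Qed.

(** The third row T enters as the default value of [nth], reached at index 2. *)
Lemma det_rows3 E G T :
  \det (\matrix_(j < 3, i < 3) nth T [:: E; G] j i) = \sum_i T i * cross E G i.
Proof.
have Ev (f : 'I_3 -> R) i : f i = f (inord i) by rewrite inord_val.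
under eq_mx => j i do rewrite Ev.
rewrite (det_nat3 (fun j i => nth T [:: E; G] j (inord i))) /=.
rewrite !big_ord_recl big_ord0 /cross addr0 addrA.
by congr (_ + _ + _); congr (T _ * (E _ * G _ - E _ * G _));
  apply/val_inj; rewrite /= inordK.
Qed.

End CrossProduct.

(** * The Euler and Frobenius derivations *)

Section FrobeniusDerivation.
Variables (F : finFieldType) (l : nat).
Local Notation q := #|F|.
Local Notation S := {mpoly F[l]}.

(** The monomial x_i x_j^q has coefficient 1, as the other one has exponent q > 1 at i. *)
Lemma frob_minor_neq0 (i j : 'I_l) : i != j -> frob_minor F i j != 0.
Proof.
move=> ij; have q1 := card_finField_gt1 F.
apply/eqP => /(congr1 (mcoeff (U_(i) + U_(j) *+ q))).
rewrite mcoeff0 raddfB /= !mpolyXn -!mpolyXD !mcoeffX eqxx.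
case: eqP => [|_]; last by apply/eqP; rewrite subr0 oner_neq0.
move/mnmP/(_ i); rewrite !mnmDE !mulmnE !mnm1E eqxx eq_sym (negPf ij).
set Q := #|F| in q1 *; lia.
Qed.

(** Raising to the power q is additive on S and fixes the coefficients, which lie in F. *)
Lemma der_apply_frob (a : 'rV[F]_l) :
  der_apply (fun i => 'X_i ^+ q) a = lin_form a ^+ q :> S.
Proof.
have [p _ pF] := finPcharP F.
have qnat : [pchar S].-nat q.
  rewrite (eq_pnat _ (pchar_lalg S)) (eq_pnat _ (pcharf_eq pF)) -cardsT.
  exact: abelem_pgroup (fin_ring_pchar_abelem pF).
have frD (x y : S) : (x + y) ^+ q = x ^+ q + y ^+ q by apply: exprDn_pchar.
have fr0 : 0 ^+ q = 0 :> S by rewrite expr0n -(ltn_predK (card_finField_gt1 F)).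
rewrite /der_apply /lin_form (big_morph (fun x : S => x ^+ q) frD fr0).
by apply: eq_bigr => i _; rewrite exprZn expf_card.
Qed.

Lemma euler_in_DA (A : seq {vspace 'rV[F]_l}) : in_DA A (fun i => 'X_i).
Proof. by move=> H _ a _; exists 1; rewrite mulr1. Qed.

Lemma frob_in_DA (A : seq {vspace 'rV[F]_l}) : in_DA A (fun i => 'X_i ^+ q).
Proof.
move=> H _ a _; exists (lin_form a ^+ q.-1); rewrite der_apply_frob -exprS.
by rewrite (ltn_predK (card_finField_gt1 F)).
Qed.

End FrobeniusDerivation.

Lemma homog_of_degE (F : fieldType) l d (p : {mpoly F[l]}) :
  p \is d.-homog -> homog_of_deg d p.
Proof. by rewrite dhomogE. Qed.

(** * The third derivation *)

Section ThreeDim.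
Variables (F : finFieldType) (A : seq {vspace 'rV[F]_3}).
Local Notation q := #|F|.
Local Notation S := {mpoly F[3]}.

(** The minors are the coordinates of x times x^q up to sign, so T is the antisymmetrised
    coefficient array. *)
Lemma frob_comb_cross e (f : S) : frob_comb e f ->
  exists2 T : 'I_3 -> S, forall i, T i \is e.-homog
    & \sum_i T i * cross (fun i => 'X_i) (fun i => 'X_i ^+ q) i = f.
Proof.
move=> [g hg ->].
exists (fun k => g (k + 1) (k + 2%:R) - g (k + 2%:R) (k + 1)) => [i|].
  by apply: dhomogD; rewrite ?dhomogN.
rewrite sum_I3_pairs; apply: eq_bigr => k _.
rewrite -/(frob_minor F (k + 1) (k + 2%:R)).
have -> : frob_minor F k k = 0 by rewrite /frob_minor subrr.
have -> : frob_minor F (k + 2%:R) (k + 1) = - frob_minor F (k + 1) (k + 2%:R).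
  by rewrite /frob_minor opprB.
by rewrite mulr0 add0r mulrN mulrBl.
Qed.

(** Modulo the form of [a], the vector [a] is orthogonal to x and x^q, and T to their cross product
    because the form divides [f]; hence [a] is orthogonal to T. *)
Lemma third_in_DA (T : 'I_3 -> S) (f : S) :
  \sum_i T i * cross (fun i => 'X_i) (fun i => 'X_i ^+ q) i = f ->
  (forall H, H \in A -> forall a, defines a H -> a != 0) ->
  (forall H, H \in A -> forall a, defines a H -> exists g, f = lin_form a * g) ->
  in_DA A T.
Proof.
move=> Tf nz dvd H HA a aH; have [k ak] := rV_neq0P (nz H HA a aH).
apply/(lin_form_dvdP _ ak).
set E : 'I_3 -> S := fun i => 'X_i in Tf *.
set G : 'I_3 -> S := fun i => 'X_i ^+ q in Tf *.
pose C := fun i => (a 0 i)%:MP_[3].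
have sE (X : 'I_3 -> S) :
    proj_lin a k (der_apply X a) = \sum_i C i * proj_lin a k (X i).
  rewrite /der_apply raddf_sum; apply: eq_bigr => i _.
  by rewrite /= linearZ /= mul_mpolyC.
have hE : \sum_i C i * proj_lin a k (E i) = 0.
  by rewrite -sE; apply: proj_lin_form.
have hG : \sum_i C i * proj_lin a k (G i) = 0.
  rewrite -sE der_apply_frob rmorphXn /= proj_lin_form //.
  by rewrite expr0n -(ltn_predK (card_finField_gt1 F)).
have hT : \sum_i proj_lin a k (T i) * cross (fun i => proj_lin a k (E i))
    (fun i => proj_lin a k (G i)) i = 0.
  rewrite -[RHS]((lin_form_dvdP _ ak).1 (dvd H HA a aH)) -Tf raddf_sum.
  by apply: eq_bigr => i _; rewrite /= /cross rmorphM rmorphB !rmorphM.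
have /eqP := cross_annihilates k hE hG hT.
rewrite -sE mulf_eq0 => /orP[/eqP // | /eqP c0].
(* The k-th coordinate of the cross product involves only the two variables fixed by [proj_lin a k],
   so it remains a nonzero minor. *)
have k1 : k + 1 != k by rewrite -subr_eq0 addrC addKr.
have k2 : k + 2%:R != k by rewrite -subr_eq0 addrC addKr.
have k12 : k + 1 != k + 2%:R by rewrite (inj_eq (addrI k)).
move: c0; rewrite /cross /E /G !rmorphXn /= !proj_linX //.
by move/eqP; rewrite -/(frob_minor F _ _) (negPf (frob_minor_neq0 F k12)).
Qed.

End ThreeDim.

(** * Freeness of arrangements that cover the space *)

Theorem mainTheorem5 (F : finFieldType) (A : seq {vspace 'rV[F]_3}) :
  is_arrangement A ->
  (arr_charpoly A).[(#|F|)%:Z] = 0 ->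
  exists d3 : nat, (1 + #|F| + d3)%N = size A /\
    free_with_exponents A (exps3 1 #|F| d3).
Proof.
move=> arrA; have /andP[uA /allP hA] := arrA.
have nfull : all (fun H => H != fullv) A.
  apply/allP => H /hA /eqP dH; apply/eqP => Hf.
  by move: dH; rewrite Hf dimv_rVf.
rewrite charpoly_card // => -[] /card0_eq covered0.
have covered (v : 'rV[F]_3) : exists2 H, H \in A & v \in H.
  apply/hasP; have := covered0 v; rewrite inE.
  by move/negbFE.
have [al alP] := fin_all_exists (fun i : 'I_(size A) =>
  @hyperplane_form F 3 _ isT (hA _ (mem_nth 0%VS (ltn_ord i)))).
pose f := def_poly al.
have f0 (v : 'I_3 -> F) : f.@[v] = 0.
  have [H HA] := covered (\row_i v i).
  have iA : (index H A < size A)%N by rewrite index_mem.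
  have := alP (Ordinal iA); rewrite /= nth_index // => alH.
  rewrite (mem_defines _ alH) => /eqP vH.
  rewrite /f /def_poly rmorph_prod (bigD1 (Ordinal iA)) //=.
  rewrite -(meval_eq _ (v1 := fun i => (\row_j v j) 0 i)) ?vH ?mul0r // => i.
  by rewrite mxE.
have [e de fc] := vanishing_frob_comb (def_poly_homog al)
  (def_poly_neq0 (l := 3) isT arrA alP) f0.
have [T hT Tf] := frob_comb_cross fc.
exists e; split; first by rewrite -de addnC add1n.
have TA : in_DA A T.
  apply: (third_in_DA Tf) => [H HA a|H HA a aH].
    exact: (@defines_neq0 F 3 _ _ isT (hA H HA)).
  exact: (lin_form_dvd_def_poly (l := 3) isT arrA alP HA aH).
pose M : 'M[{mpoly F[3]}]_3 :=
  \matrix_(j < 3, i < 3) nth T [:: fun i => 'X_i; fun i => 'X_i ^+ #|F|] j i.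
have ME j : M j =1 nth T [:: fun i => 'X_i; fun i => 'X_i ^+ #|F|] j.
  by move=> i; rewrite mxE.
apply: (saito_criterion (l := 3) isT arrA alP (M := M)).
- move=> j; suff: in_DA A (nth T [:: fun i => 'X_i; fun i => 'X_i ^+ #|F|] j).
    move=> dj H HA a aH; have [g eg] := dj H HA a aH; exists g; rewrite -eg.
    by apply: eq_bigr => i _; rewrite ME.
  case: j => [[|[|[|j]]] ltj] //=; first exact: euler_in_DA.
  exact: frob_in_DA.
- move=> j i; rewrite ME; apply: homog_of_degE.
  have X1 : ('X_i : {mpoly F[3]}) \is 1.-homog by rewrite dhomogX; apply/eqP/mdeg1.
  have := dhomogMn #|F| X1; rewrite mul1n.
  by case: j => [[|[|[|j]]] ltj] //= _; apply: hT.
by rewrite det_rows3.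
Qed.
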